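(* Let $m\ge n\ge 0$ be integers such that $d:=m-n$ is even, and let $\alpha\in\mathbb{C}$ with $\Re\alpha>-1$. Then $$\int_0^1\!\!\int_0^1 |x-y|^{\alpha}\,p_m(x)\,p_n(y)\,dx\,dy \;=\;\frac{2}{\alpha+1}\;\frac{\left(\frac{d-\alpha}{2}\right)_{n}\,(-\alpha-1)_{d}}{\left(\frac{\alpha+d+4}{2}\right)_{n}\,(\alpha+2)_{d+1}} .$$
   Context: $P_n$ denotes the Legendre polynomial of degree $n$ (orthogonal on $[-1,1]$, normalized by $P_n(1)=1$), and $p_n(x)=P_n(2x-1)$ is the shifted Legendre polynomial on $[0,1]$. For $a\in\mathbb{C}$ and an integer $k\ge0$, $(a)_k=a(a+1)\cdots(a+k-1)$ with $(a)_0=1$. *)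

(* Defs.v *)
From HB Require Import structures.
From mathcomp Require Import all_boot all_order all_algebra.
From mathcomp Require Import complex.
From mathcomp Require Import all_classical all_reals all_analysis.

Set Implicit Arguments.
Unset Strict Implicit.
Unset Printing Implicit Defensive.

Import Order.TTheory GRing.Theory Num.Theory.
Import numFieldNormedType.Exports.

Local Open Scope classical_set_scope.
Local Open Scope ring_scope.
Local Open Scope complex_scope.

(* The three clauses determine P uniquely. *)
Definition legendre_family (R : realType) (P : nat -> {poly R}) : Prop :=
  [/\ forall n, size (P n) = n.+1,
      forall m n, m != n ->
        \int[lebesgue_measure]_(x in `[(-1 : R), 1]) ((P m).[x] * (P n).[x]) = 0
    & forall n, (P n).[1] = 1].

Definition shifted (R : realType) (p : {poly R}) : {poly R} :=
  p \Po (2%:P * 'X - 1).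

Definition pochhammer (K : pzRingType) (a : K) (k : nat) : K :=
  \prod_(i < k) (a + i%:R).

Definition cexp (R : realType) (z : R[i]) : R[i] :=
  (expR (complex.Re z))%:C *
  (cos (complex.Im z) +i* sin (complex.Im z)).

(* Since ln 0 = 0 in the library, the value at t = 0 is the junk value 1; in
   |x - y|^alpha this only concerns the diagonal, which has measure zero. *)
Definition cpow (R : realType) (t : R) (a : R[i]) : R[i] :=
  cexp (a * (ln t)%:C).

Section ComplexIntegral.
Context d (T : measurableType d) (R : realType).
Variable mu : {measure set T -> \bar R}.

Definition cintegrable (D : set T) (f : T -> R[i]) : Prop :=
  mu.-integrable D (fun t => (complex.Re (f t))%:E) /\
  mu.-integrable D (fun t => (complex.Im (f t))%:E).

Definition cintegral (D : set T) (f : T -> R[i]) : R[i] :=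
  (\int[mu]_(t in D) complex.Re (f t)) +i*
  (\int[mu]_(t in D) complex.Im (f t)).

End ComplexIntegral.

Definition lebesgue2 (R : realType) :
    {measure set (measurableTypeR R * measurableTypeR R) -> \bar R} :=
  (@lebesgue_measure R \x @lebesgue_measure R)%E.

Definition unit_square (R : realType) : set (R * R) :=
  `[0, 1] `*` `[0, 1].

Arguments lebesgue2 R : clear implicits.
Arguments unit_square R _ : clear implicits.

(* Main.v *)
Require Import Defs.
From HB Require Import structures.
From mathcomp Require Import all_boot all_order all_algebra.
From mathcomp Require Import complex.
From mathcomp Require Import all_classical all_reals all_analysis.
From mathcomp Require Import measurable_realfun.
From mathcomp Require Import ring lra.

Set Implicit Arguments.
Unset Strict Implicit.
Unset Printing Implicit Defensive.

Import Order.TTheory GRing.Theory Num.Theory.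
Import numFieldNormedType.Exports.

Local Open Scope classical_set_scope.
Local Open Scope ring_scope.
Local Open Scope complex_scope.

(** Let S be the unit square, s = alpha + 1, p = p_m and q = p_n.

    The diagonal cuts S into two triangles, which the point reflection
    (x, y) |-> (1 - x, 1 - y) exchanges.  It preserves |x - y| and multiplies
    p_m(x) p_n(y) by (-1)^(m + n), that is by 1 since m - n is even; so the
    integral is twice the integral over the triangle y < x.

    On that triangle the inner integral is elementary: the kernel
    (x - y)^alpha turns y^j into x^(s + j) j! / (s)_{j+1}, a Beta integral.
    Hence, B being the diagonal operator X^j |-> j! / (s)_{j+1} X^j ([beta_op]),
    the triangle contributes the integral of x^s p(x) (B q)(x), which is a
    finite combination of the moments of p at s + 1, s + 2 and so on
    ([half_pairing], [cintegral_cpow_dist2]).  Here the moment of p at u is the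
    integral of x^(u - 1) p(x), namely the sum of p_k / (u + k).

    The moment at u is a rational function of u with denominator (u)_{m+1} and
    a numerator of degree at most m.  Orthogonality of p_m to 1, ..., x^(m-1)
    says that the numerator vanishes at u = 1, ..., m, hence it is a multiple of
    (1 - u)_m ([moment_orthogonal]); comparing residues at the poles gives the
    coefficients of p_m ([coef_orthogonal]), and thereby the parity
    ([legendre_reflect]).

    Inserting both, what is left is a terminating 3F2 at 1 of Whipple type,
      sum_j (-n)_j (n+1)_j / j! (1-b-j)_m / ((b-1)_{j+1} (b+j)_{m+1}), b = s + 1.
    Keeping d = m - n fixed and raising n, creative telescoping
    ([wz_telescope]) shows that it satisfies a first-order recurrence, and
    n = 0 is immediate ([wzsum_closed]).

    On the analytic side the kernel may be singular on the diagonal, since Re alpha is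
    only bounded below by -1.  Everything rests on one antiderivative: on t > 0,
    t^alpha Q(t) is the derivative of t^alpha t M(t), where M has coefficients
    Q_k / (s + k) ([cprim_derive]), and this antiderivative is continuous up to
    t = 0 because Re s > 0.  A fundamental theorem of calculus that allows
    singular end points ([ge0_integrable_primitive], [Rintegral_FTC2_oo])
    then yields both the integrability and the value of all one-dimensional
    integrals, and Tonelli and Fubini transfer them to the square. *)

(** * Rising factorials *)

Lemma pochhammer0 (K : pzRingType) (a : K) : pochhammer a 0 = 1.
Proof. by rewrite /pochhammer big_ord0. Qed.

Lemma pochhammerSr (K : pzRingType) (a : K) k :
  pochhammer a k.+1 = pochhammer a k * (a + k%:R).
Proof. by rewrite /pochhammer big_ord_recr. Qed.

Lemma pochhammerSl (K : pzRingType) (a : K) k :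
  pochhammer a k.+1 = a * pochhammer (a + 1) k.
Proof.
rewrite /pochhammer big_ord_recl /= addr0; congr (_ * _).
by apply: eq_bigr => i _; rewrite /bump /= add1n -natr1 [_ + 1]addrC addrA.
Qed.

Lemma pochhammer_neq0 (K : idomainType) (a : K) k :
  (forall i : nat, a + i%:R != 0) -> pochhammer a k != 0.
Proof. by move=> ha; apply/prodf_neq0 => i _. Qed.

(** * Moments of polynomials *)

Section Moments.
Variable K : numFieldType.
Implicit Types (s x c : K) (p q : {poly K}).

(** The polynomial M such that t^s M(t) is an antiderivative of t^(s-1) q(t). *)
Definition mprim s q : {poly K} := \poly_(k < size q) (q`_k / (s + k%:R)).

Lemma coef_mprim s q k : (mprim s q)`_k = q`_k / (s + k%:R).
Proof.
rewrite coef_poly; case: ltnP => // kq.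
by rewrite nth_default ?mul0r.
Qed.

Lemma mprim_is_linear s : linear (mprim s).
Proof.
move=> c p q; apply/polyP => k.
by rewrite coefD coefZ !coef_mprim coefD coefZ mulrDl mulrA.
Qed.

HB.instance Definition _ s :=
  GRing.isLinear.Build K {poly K} {poly K} _ (mprim s) (mprim_is_linear s).

Lemma mprim_XM s q : mprim s ('X * q) = 'X * mprim (s + 1) q.
Proof.
apply/polyP => k; rewrite coefXM !coef_mprim coefXM.
case: k => [|k]; first by rewrite !eqxx mul0r.
by rewrite /= -[k.+1%:R]natr1 [k%:R + 1]addrC addrA.
Qed.

(** The derivative of t^(s-1) (t M(t)), divided by t^(s-1) and written without
    powers of t, so that it makes sense for an arbitrary scalar s. *)
Lemma mprim_ode s q : (forall k : nat, s + k%:R != 0) ->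
  (s - 1) *: mprim s q + ('X * mprim s q)^`() = q.
Proof.
move=> hs; apply/polyP => k.
rewrite coefD coefZ coef_deriv coefXM /= coef_mprim -[_ *+ k.+1]mulr_natr -[k.+1%:R]natr1.
by field; rewrite hs.
Qed.

(** The algebraic form of the integral of t^(s-1) q(t) over [0, 1]. *)
Definition moment s q : K := (mprim s q).[1].

Lemma moment_is_linear s : linear_for *%R (moment s).
Proof. by move=> c p q; rewrite /moment linearP hornerD hornerZ. Qed.

HB.instance Definition _ s :=
  GRing.isLinear.Build K {poly K} K _ (moment s) (moment_is_linear s).

Lemma moment_XnM s k q : moment s ('X^k * q) = moment (s + k%:R) q.
Proof.
elim: k s => [|k IH] s; first by rewrite expr0 mul1r addr0.
rewrite exprS -mulrA /moment mprim_XM hornerM hornerX mul1r.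
rewrite -[LHS]/(moment (s + 1) _) IH.
by rewrite -[k.+1%:R]natr1 [k%:R + 1]addrC addrA.
Qed.

Lemma momentE s q N : (size q <= N)%N ->
  moment s q = \sum_(k < N) q`_k / (s + k%:R).
Proof.
move=> qN; rewrite /moment (@horner_coef_wide _ N); last first.
  exact: leq_trans (size_poly _ _) qN.
by apply: eq_bigr => k _; rewrite coef_mprim expr1n mulr1.
Qed.

Lemma moment_mulE s p q :
  moment s (p * q) = \sum_(j < size q) q`_j * moment (s + j%:R) p.
Proof.
rewrite -{1}(coefK q) poly_def mulr_sumr linear_sum /=.
apply: eq_bigr => j _.
by rewrite -scalerAr linearZ /= mulrC [p * _]mulrC moment_XnM mulrC.
Qed.

(** [moment 1] is integration over [0, 1]. *)
Lemma moment_deriv q : moment 1 q^`() = q.[1] - q.[0].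
Proof.
case: (eqVneq q 0) => [->|q0]; first by rewrite deriv0 linear0 !horner0 subrr.
have sq : (size q).-1.+1 = size q by rewrite prednK// size_poly_gt0.
rewrite (@momentE _ _ (size q).-1); last by rewrite -ltnS sq lt_size_deriv.
rewrite horner_coef horner_coef0 -[in RHS]sq big_ord_recl.
rewrite expr1n mulr1 addrC addKr; apply: eq_bigr => k _.
rewrite coef_deriv lift0 expr1n mulr1 -[_ *+ k.+1]mulr_natr addrC natr1.
by rewrite mulfK// pnatr_eq0.
Qed.

Lemma one_plus_nat_neq0 (k : nat) : 1 + k%:R != 0 :> K.
Proof. by rewrite addrC natr1 pnatr_eq0. Qed.

Lemma exists_primitive q : exists W : {poly K}, W^`() = q.
Proof.
exists ('X * mprim 1 q).
by have := mprim_ode q one_plus_nat_neq0; rewrite subrr scale0r add0r.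
Qed.

(** Both q and its reflection have explicit antiderivatives, so the
    substitution rule needs no integral. *)
Lemma moment1_reflect q : moment 1 (q \Po (1 - 'X)) = moment 1 q.
Proof.
have [W <-] := exists_primitive q.
have -> : W^`() \Po (1 - 'X) = (- (W \Po (1 - 'X)))^`().
  rewrite derivN deriv_comp derivB derivX -[1]/(1%:P) derivC sub0r.
  by rewrite mulrN1 opprK.
rewrite !moment_deriv !hornerN !horner_comp !hornerE subrr subr0.
by rewrite opprK addrC.
Qed.

(** The Beta integral of u^(s-1) (1-u)^j over [0, 1]. *)
Definition beta_coef s j : K := j`!%:R / pochhammer s j.+1.

(** Up to a power of x, the integral of t^(s-1) (x - t)^j over [0, x]; writing
    one factor as x - t is the contiguity relation between the Beta integrals
    at (s, j), (s + 1, j) and (s, j + 1). *)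
Lemma mprim_sub_exp s x j : (forall k : nat, s + k%:R != 0) ->
  (mprim s ((x%:P - 'X) ^+ j)).[x] = x ^+ j * beta_coef s j.
Proof.
elim: j s => [|j IH] s hs.
  have -> : mprim s ((x%:P - 'X) ^+ 0) = (s^-1)%:P.
    apply/polyP => k; rewrite coef_mprim expr0 coef1 coefC.
    by case: k => [|k] /=; rewrite ?addr0 ?mul1r ?mul0r.
  by rewrite hornerC expr0 mul1r /beta_coef pochhammerSr pochhammer0 fact0 addr0 !mul1r.
have hs1 k : s + 1 + k%:R != 0 by rewrite -addrA [1 + _]addrC natr1.
have h0 : s != 0 by have := hs 0%N; rewrite addr0.
rewrite exprS mulrBl mul_polyC linearB linearZ /= mprim_XM.
rewrite hornerD hornerN hornerZ hornerM hornerX !IH// exprS.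
rewrite /beta_coef factS natrM -natr1.
rewrite [pochhammer s j.+2]pochhammerSl [pochhammer s j.+1]pochhammerSl.
rewrite !(pochhammerSr (s + 1)).
have p0 : pochhammer (s + 1) j != 0 by exact: pochhammer_neq0.
by field; rewrite p0 h0 hs1.
Qed.

(** Convolution with t^(s-1) sends y^j to [beta_coef s j] x^(s+j); this is its
    polynomial factor. *)
Definition beta_op s q : {poly K} := \poly_(j < size q) (q`_j * beta_coef s j).

Lemma mprim_comp_sub s x q : (forall k : nat, s + k%:R != 0) ->
  (mprim s (q \Po (x%:P - 'X))).[x] = (beta_op s q).[x].
Proof.
move=> hs; rewrite comp_polyE linear_sum horner_sum /beta_op horner_poly.
apply: eq_bigr => j _; rewrite linearZ /= hornerZ mprim_sub_exp//.
by rewrite mulrCA mulrC mulrA.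
Qed.

Lemma beta_opZ s c q : beta_op s (c *: q) = c *: beta_op s q.
Proof.
have co r j : (beta_op s r)`_j = r`_j * beta_coef s j.
  by rewrite coef_poly; case: ltnP => // h; rewrite nth_default ?mul0r.
by apply/polyP => j; rewrite coefZ !co coefZ mulrA.
Qed.

End Moments.

(** * Orthogonality and partial fractions *)

Section PartialFractions.
Variable K : numFieldType.
Implicit Types (s : K) (q : {poly K}).

(** The numerator of the moment of q, as a function of s, over the common
    denominator s (s + 1) ... (s + n). *)
Definition pfnum n q : {poly K} :=
  \sum_(j < n.+1) q`_j *: \prod_(i < n.+1 | i != j) ('X - (- i%:R)%:P).

Lemma size_pfnum n q : (size (pfnum n q) <= n.+1)%N.
Proof.
apply: (leq_trans (size_sum _ _ _)); apply/bigmax_leqP => j _.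
apply: (leq_trans (size_scale_leq _ _)).
rewrite -big_filter size_prod_XsubC -cardE.
by rewrite (eq_card (B := predC1 j))// cardC1 card_ord.
Qed.

Lemma horner_pfnum n q s :
  (pfnum n q).[s] = \sum_(j < n.+1) q`_j * \prod_(i < n.+1 | i != j) (s + i%:R).
Proof.
rewrite /pfnum horner_sum; apply: eq_bigr => j _.
rewrite hornerZ horner_prod; congr (_ * _).
by apply: eq_bigr => i _; rewrite hornerXsubC opprK.
Qed.

Lemma pfnum_moment n q s : (size q <= n.+1)%N ->
  (forall k : nat, s + k%:R != 0) ->
  (pfnum n q).[s] = pochhammer s n.+1 * moment s q.
Proof.
move=> sq hs; rewrite horner_pfnum (momentE _ sq) mulr_sumr.
apply: eq_bigr => j _; rewrite /pochhammer [X in _ = X * _](bigD1 j)//=.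
by set P := \prod_(i < _ | _) _; field.
Qed.

(** At the pole s = -j only the residue of the j-th fraction survives. *)
Lemma pfnum_pole n q (j : 'I_n.+1) :
  (pfnum n q).[- j%:R] = q`_j * \prod_(i < n.+1 | i != j) (- j%:R + i%:R).
Proof.
rewrite horner_pfnum (bigD1 j)//= [X in _ + X]big1 ?addr0// => k kj.
by rewrite (bigD1 j) 1?eq_sym//= addNr mul0r mulr0.
Qed.

Lemma pochhammer_Nn n : pochhammer (- n%:R) n = (-1) ^+ n * n`!%:R :> K.
Proof.
elim: n => [|n IH]; first by rewrite pochhammer0 fact0 mulr1.
have e : - n.+1%:R + 1 = - n%:R :> K by rewrite -natr1; ring.
by rewrite pochhammerSl e IH factS natrM exprS; ring.
Qed.

Lemma pochhammer_N_eq0 n j : (n < j)%N -> pochhammer (- n%:R) j = 0 :> K.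
Proof.
move=> nj; rewrite /pochhammer (bigD1 (Ordinal nj))//=.
by rewrite addNr mul0r.
Qed.

Lemma pochhammer_fact n j : pochhammer (n%:R + 1) j * n`!%:R = (n + j)`!%:R :> K.
Proof.
elim: j => [|j IH]; first by rewrite pochhammer0 mul1r addn0.
rewrite addnS factS natrM -IH pochhammerSr -natr1 natrD; ring.
Qed.

(** The product over i is (-1)^j j! (n - j)!; multiplying by (-n)_j, which is
    (-1)^j n! / (n - j)!, removes the sign and the subtraction. *)
Lemma prod_pole n (j : nat) : (j <= n)%N ->
  pochhammer (- n%:R) j * \prod_(i < n.+1 | i != j :> nat) (- j%:R + i%:R) =
  j`!%:R * n`!%:R :> K.
Proof.
move=> jn.
rewrite -(big_mkord (fun i => i != j) (fun i => - j%:R + i%:R)).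
elim: n jn => [|n IH] jn.
  move: jn; rewrite leqn0 => /eqP ->.
  by rewrite pochhammer0 big_mkcond big_nat1 eqxx !mul1r.
rewrite big_mkcond big_nat_recr//= -big_mkcond /=.
move: jn; rewrite leq_eqVlt => /predU1P[->|jn].
  rewrite eqxx mulr1 big_nat_cond (eq_bigl (fun i => 0 <= i < n.+1)%N); last first.
    by move=> i; case: ltngtP.
  rewrite -big_nat big_mkord -[X in _ * X]/(pochhammer _ _) pochhammer_Nn.
  by rewrite mulrACA -expr2 -exprM mulnC exprM sqrrN !expr1n mul1r.
have {}IH := IH jn.
rewrite gtn_eqF//=.
have e : pochhammer (- n.+1%:R) j * (- n.+1%:R + j%:R) =
    - n.+1%:R * pochhammer (- n%:R) j :> K.
  by rewrite -pochhammerSr pochhammerSl; congr (_ * pochhammer _ _); rewrite -natr1; ring.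
rewrite factS natrM [RHS]mulrCA -IH.
transitivity (- (pochhammer (- n.+1%:R) j * (- n.+1%:R + j%:R)) *
  \prod_(0 <= i < n.+1 | i != j) (- j%:R + i%:R) : K); first by ring.
by rewrite e; ring.
Qed.

(** The difference of the two sides has degree at most n and the n + 1 roots
    0, 1, ..., n: at 1, ..., n both vanish, and at 0 only the constant
    coefficient of q contributes. *)
Lemma pfnum_orthogonal n q : (size q <= n.+1)%N ->
  (forall k, (k < n)%N -> moment k.+1%:R q = 0) ->
  pfnum n q = q`_0 *: \prod_(k < n) (k.+1%:R%:P - 'X).
Proof.
move=> sq hq; apply/eqP; rewrite -subr_eq0; apply/eqP.
set D := _ - _.
have sD : (size D <= n.+1)%N.
  apply: (leq_trans (size_polyD _ _)); rewrite geq_max size_pfnum size_polyN.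
  apply: (leq_trans (size_scale_leq _ _)).
  apply: (leq_trans (size_poly_prod_leq _ _)).
  rewrite leq_subLR card_ord addnS ltnS addnn -muln2.
  apply: (@leq_trans (\sum_(i < n) 2)); last by rewrite sum_nat_const card_ord.
  by apply: leq_sum => i _; rewrite -opprB size_polyN size_XsubC.
have hD (k : nat) : (k <= n)%N -> root D k%:R.
  move=> kn; rewrite /root /D hornerD hornerN hornerZ horner_prod.
  case: k kn => [_|k kn].
    have h0 : \prod_(i < n.+1 | i != ord0) (- 0%:R + i%:R) = n`!%:R :> K.
      have := @prod_pole n 0 (leq0n n); rewrite pochhammer0 fact0 !mul1r => <-.
      exact: eq_bigl.
    have -> : (pfnum n q).[0%:R] = q`_0 * n`!%:R.
      by rewrite -h0 -(@pfnum_pole n q ord0) oppr0.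
    rewrite -[X in _ - _ * X]/(\prod_(i < n) (i.+1%:R%:P - 'X).[0]).
    rewrite (eq_bigr (fun i : 'I_n => i.+1%:R)); last first.
      by move=> i _; rewrite hornerD hornerN hornerC hornerX subr0.
    by rewrite -natr_prod fact_prod big_add1 big_mkord subrr.
  rewrite [X in _ - _ * X](bigD1 (Ordinal kn))//=.
  rewrite hornerD hornerN hornerC hornerX subrr mul0r mulr0 subr0.
  rewrite pfnum_moment ?hq ?mulr0// => i; by rewrite -natrD addSn pnatr_eq0.
apply/eqP; apply: contraTT sD => D0; rewrite -ltnNge.
have := @max_poly_roots _ D [seq k%:R | k <- iota 0 n.+1] D0.
rewrite size_map size_iota; apply.
  by apply/allP => _ /mapP[k + ->]; rewrite mem_iota /= add0n ltnS => /hD.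
by rewrite map_inj_uniq ?iota_uniq// => i j /eqP; rewrite eqr_nat => /eqP.
Qed.

Lemma moment_orthogonal n q s : (size q <= n.+1)%N ->
  (forall k, (k < n)%N -> moment k.+1%:R q = 0) ->
  (forall k : nat, s + k%:R != 0) ->
  moment s q = q`_0 * pochhammer (1 - s) n / pochhammer s n.+1.
Proof.
move=> sq hq hs; have := pfnum_moment sq hs.
rewrite (pfnum_orthogonal sq hq) hornerZ horner_prod => e.
have -> : pochhammer (1 - s) n = \prod_(i < n) (i.+1%:R%:P - 'X).[s].
  by apply: eq_bigr => i _; rewrite hornerD hornerN hornerC hornerX -natr1 addrC addrA.
rewrite e mulrC mulKf//; exact: pochhammer_neq0.
Qed.

(** Comparison of the residues at s = -j of the two expressions of the moment. *)
Lemma coef_orthogonal n q j : (size q <= n.+1)%N ->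
  (forall k, (k < n)%N -> moment k.+1%:R q = 0) ->
  q`_j = q`_0 * (pochhammer (- n%:R) j * pochhammer (n%:R + 1) j / j`!%:R ^+ 2).
Proof.
move=> sq hq; have [nj|jn] := ltnP n j.
  by rewrite nth_default ?pochhammer_N_eq0 ?(leq_trans sq)// !mul0r mulr0.
have := @pfnum_pole n q (inord j); rewrite inordK// => e.
have := congr1 (fun x => pochhammer (- n%:R) j * x) e.
rewrite mulrCA (eq_bigl (fun i : 'I_n.+1 => i != j :> nat)); last first.
  by move=> i; rewrite -val_eqE /= inordK.
rewrite prod_pole// (pfnum_orthogonal sq hq) hornerZ horner_prod.
rewrite (eq_bigr (fun i : 'I_n => j%:R + 1 + i%:R)); last first.
  by move=> i _; rewrite hornerD hornerN hornerC hornerX opprK -[i.+1%:R]natr1; ring.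
rewrite -[\prod_(i < n) _]/(pochhammer _ _) => {}e.
have := pochhammer_fact j n; rewrite addnC -pochhammer_fact => f.
have fn0 k : k`!%:R != 0 :> K by rewrite pnatr_eq0 -lt0n fact_gt0.
apply: (mulIf (fn0 n)); apply: (mulIf (fn0 j)).
rewrite -mulrA [n`!%:R * _]mulrC -e.
transitivity (q`_0 * pochhammer (- n%:R) j / j`!%:R * (pochhammer (n%:R + 1) j * n`!%:R)).
  by rewrite -f; field.
by field.
Qed.

End PartialFractions.

(** * A terminating Whipple sum *)

Section WZ.
Variable K : numFieldType.
Variable b : K.
Hypothesis hb : forall k : nat, b - 1 + k%:R != 0.

(** The factor (-n)_j makes the terms with j > n vanish. *)
Definition wzterm (m n j : nat) : K :=
  pochhammer (- n%:R) j * pochhammer (n%:R + 1) j / j`!%:R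
  * (pochhammer (1 - b - j%:R) m
     / (pochhammer (b - 1) j.+1 * pochhammer (b + j%:R) m.+1)).

Lemma wz_den_neq0 (j k : nat) : b + j%:R + k%:R != 0.
Proof.
have := hb (j + k).+1; congr (_ != _).
by rewrite -natr1 natrD; ring.
Qed.

(** Zeilberger's method with the shift (m, n) -> (m+1, n+1): the combination is
    G (j+1) - G j with
    G j = 2 j (b + j - 1 - m) / (n + 1 - j) * wzterm m n j.
    The right-hand side is G (k+1) with the quotient by n + 1 - j cancelled
    against (-n)_j, which keeps it meaningful at j = n + 1. *)
Lemma wz_telescope m n k :
  \sum_(j < k.+1) ((b + m%:R + n%:R + 2) * wzterm m.+1 n.+1 j
               - (m%:R + n%:R + 2 - b) * wzterm m n j) =
  2 * pochhammer (- n%:R) k * pochhammer (n%:R + 1) k.+1 / k`!%:R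
  * (pochhammer (- b - k%:R) m.+1
     / (pochhammer (b - 1) k.+2 * pochhammer (b + k.+1%:R) m.+1)).
Proof.
have fn0 i : i`!%:R != 0 :> K by rewrite pnatr_eq0 -lt0n fact_gt0.
elim: k => [|k IH].
  rewrite big_ord1 /wzterm !pochhammer0 fact0 !subr0 !addr0 !mul1r divr1.
  rewrite (pochhammerSr (b - 1) 1) !(pochhammerSr _ 0) !pochhammer0.
  rewrite !(pochhammerSr (1 - b)) (pochhammerSl (- b)) !(pochhammerSl b).
  rewrite !(pochhammerSr (b + 1)) [- b + 1]addrC.
  have h0 := hb 0; have h1 := wz_den_neq0 0 0; have h2 := wz_den_neq0 1 m.
  have h3 : pochhammer (b + 1) m != 0.
    by apply: pochhammer_neq0 => i; exact: (wz_den_neq0 1 i).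
  rewrite !addr0 in h0 h1; field.
  by rewrite h0 h2 h3 subrK h1.
rewrite big_ord_recr IH /= {IH} /wzterm.
have h7 : n.+1%:R != 0 :> K by rewrite pnatr_eq0.
(* All factors are expressed through (-n)_k, (n+1)_{k+1}, k!, (x)_m,
   (b+k+2)_m and (b-1)_{k+2}, after which the identity is rational. *)
set x := 1 - b - k.+1%:R.
have -> : - b - k%:R = x by rewrite /x -natr1; ring.
rewrite !(pochhammerSr x) (pochhammerSl (- b - k.+1%:R)).
have -> : - b - k.+1%:R + 1 = x by rewrite /x; ring.
rewrite !(pochhammerSl (b + k.+1%:R)) (pochhammerSr _ k.+2).
have -> : b + k.+2%:R = b + k.+1%:R + 1 by rewrite -[k.+2%:R]natr1; ring.
rewrite !(pochhammerSr (b + k.+1%:R + 1)).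
rewrite (pochhammerSr (- n%:R) k) (pochhammerSl (- n.+1%:R) k).
have -> : - n.+1%:R + 1 = - n%:R :> K by rewrite -natr1; ring.
have -> : pochhammer (n.+1%:R + 1) k.+1 =
    pochhammer (n%:R + 1) k.+1 * (n%:R + 1 + k.+1%:R) / n.+1%:R :> K.
  by rewrite -pochhammerSr [pochhammer _ k.+2]pochhammerSl !natr1 [RHS]mulrC mulKf.
rewrite (pochhammerSr (n%:R + 1) k.+1) factS natrM.
have h1 := wz_den_neq0 k.+1 0; have h2 := wz_den_neq0 k.+1 m.+1; have h3 := hb k.+2.
have h4 : pochhammer (b + k.+1%:R + 1) m != 0.
  apply: pochhammer_neq0 => i; have := wz_den_neq0 k.+1 i.+1.
  by rewrite -[i.+1%:R]natr1 [_ + 1]addrC addrA.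
have h5 : pochhammer (b - 1) k.+2 != 0 by exact: pochhammer_neq0.
have h6 := fn0 k.
have h8 : k%:R + 1 != 0 :> K by rewrite natr1 pnatr_eq0.
move: h4 h5 h6; set P1 := pochhammer (- n%:R) k; set P2 := pochhammer (n%:R + 1) _.
set P3 := pochhammer x m; set P4 := pochhammer (b + _ + 1) m.
set P5 := pochhammer (b - 1) _; set F := k`!%:R => h4 h5 h6.
clearbody P1 P2 P3 P4 P5 F; rewrite {}/x.
move: h1 h2 h3 h7; rewrite addr0 -!natr1 => h1 h2 h3 h7.
field.
move: h2; rewrite [m%:R + 1]addrC addrA => h2.
by rewrite h2 h3 h4 h5 h6 h7 h8.
Qed.

Lemma wzterm_eq0 m n j : (n < j)%N -> wzterm m n j = 0.
Proof. by move=> nj; rewrite /wzterm pochhammer_N_eq0 ?mul0r. Qed.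

(** The factor (-n)_{n+1} = 0 annihilates the telescoped sum at k = n + 1,
    which leaves the recurrence
    (b + m + n + 2) S(m+1, n+1) = (m + n + 2 - b) S(m, n) with m = n + d. *)
Lemma wzsum_closed n d :
  (\sum_(j < n.+1) wzterm (n + d) n j) * pochhammer ((b + d%:R + 2) / 2) n =
  pochhammer ((d%:R + 2 - b) / 2) n
  * (pochhammer (1 - b) d / ((b - 1) * pochhammer b d.+1)).
Proof.
elim: n => [|n IH].
  rewrite big_ord1 /wzterm !pochhammer0 add0n fact0 divr1 !mul1r mulr1.
  by rewrite pochhammerSr pochhammer0 mul1r subr0 !addr0.
have := wz_telescope (n + d) n n.+1.
rewrite (@pochhammer_N_eq0 _ n n.+1)// mulr0 !mul0r sumrB -!mulr_sumr.
rewrite [X in _ - _ * X]big_ord_recr /= wzterm_eq0// addr0.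
rewrite addSn => /eqP; rewrite subr_eq0 => /eqP e.
have h2 : 2 != 0 :> K by rewrite pnatr_eq0.
rewrite (pochhammerSr _ n) (pochhammerSr ((d%:R + 2 - b) / 2)).
transitivity ((b + (n + d)%:R + n%:R + 2) * (\sum_(j < n.+2) wzterm (n + d).+1 n.+1 j)
    * pochhammer ((b + d%:R + 2) / 2) n / 2).
  by rewrite natrD; field.
rewrite e -(mulrA _ (\sum_(j < _) _)) IH (natrD _ n d).
have b1 := hb 0; rewrite addr0 in b1; field.
rewrite b1 pochhammer_neq0// => k; have := hb k.+1.
by rewrite -[k.+1%:R]natr1 [k%:R + 1]addrC addrA subrK.
Qed.

End WZ.

(** * Shifted Legendre polynomials *)

Section LegendreSystem.
Variable K : numFieldType.
Variable p : nat -> {poly K}.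
Hypothesis p_size : forall n, size (p n) = n.+1.
Hypothesis p_orth : forall m n : nat, m != n -> moment 1 (p m * p n) = 0.
Hypothesis p_at1 : forall n, (p n).[1] = 1.

Lemma legendre_lead_neq0 n : lead_coef (p n) != 0.
Proof. by rewrite lead_coef_eq0 -size_poly_gt0 p_size. Qed.

(** The p_i with i < n span the polynomials of degree less than n: subtract
    from q the multiple of p_i with the same leading coefficient. *)
Lemma legendre_orthogonal_low n (q : {poly K}) :
  (size q <= n)%N -> moment 1 (q * p n) = 0.
Proof.
have [k] := ubnP (size q); elim: k q => // k IH q qk qn.
have [->|q0] := eqVneq q 0; first by rewrite mul0r linear0.
set i := (size q).-1.
have si : size q = i.+1 by rewrite prednK// size_poly_gt0.
set c := lead_coef q / lead_coef (p i).
have pi0 : moment 1 (p i * p n) = 0 by rewrite p_orth// ltn_eqF// -si.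
have -> : moment 1 (q * p n) = moment 1 ((q - c *: p i) * p n).
  by rewrite mulrBl linearB /= -scalerAl [moment 1 (c *: _)]linearZ /= pi0 mulr0 subr0.
have sr : (size (q - c *: p i)%R <= i)%N.
  apply/leq_sizeP => j; rewrite leq_eqVlt coefB coefZ => /predU1P[<-|ij].
    have := mulfVK (legendre_lead_neq0 i) (lead_coef q).
    rewrite -/c !lead_coefE p_size -/i /= => ->; exact: subrr.
  by rewrite !nth_default ?mulr0 ?subrr// ?p_size// si.
apply: IH; first by rewrite (leq_ltn_trans sr)// -ltnS -si.
by rewrite (leq_trans sr)// ltnW// -si.
Qed.

Lemma moment_legendre_low n k : (k < n)%N -> moment k.+1%:R (p n) = 0.
Proof.
move=> kn; have := @legendre_orthogonal_low n 'X^k; rewrite size_polyXn => /(_ kn).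
by rewrite moment_XnM addrC natr1.
Qed.

(** The reflected polynomial has the same degree and the same vanishing moments,
    and these determine a polynomial up to a scalar; the leading
    coefficients show that the scalar is (-1)^n. *)
Lemma legendre_reflect n : p n \Po (1 - 'X) = (-1) ^+ n *: p n.
Proof.
have s1X : size (1 - 'X : {poly K}) = 2%N.
  by rewrite -opprB size_polyN size_XsubC.
have lead1X : lead_coef (1 - 'X : {poly K}) = -1.
  by rewrite -opprB lead_coefN lead_coefXsubC.
set q := p n \Po (1 - 'X).
have sq : size q = n.+1.
  by rewrite /q size_comp_poly2.
have q_low k : (k < n)%N -> moment k.+1%:R q = 0.
  move=> kn; rewrite -natr1 addrC -moment_XnM -moment1_reflect.
  rewrite comp_polyM /q -comp_polyA.
  have -> : (1 - 'X) \Po (1 - 'X) = 'X :> {poly K}.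
    by rewrite comp_polyB comp_polyX -[1]/(1%:P) comp_polyC opprB addrC subrK.
  rewrite comp_polyXr; apply: legendre_orthogonal_low.
  by rewrite size_comp_poly2// size_polyXn.
have qE : q = (q`_0 / (p n)`_0) *: p n.
  apply/polyP => j; rewrite coefZ (coef_orthogonal j _ q_low) ?sq//.
  rewrite (coef_orthogonal j _ (@moment_legendre_low n)) ?p_size//.
  rewrite [in RHS]mulrA mulfVK//.
  (* every coefficient is a multiple of the constant one, and p_n(1) = 1 *)
  apply/eqP => p0; have := p_at1 n; rewrite horner_coef big1.
    by move/eqP; rewrite eq_sym oner_eq0.
  move=> i _.
  by rewrite (coef_orthogonal i _ (@moment_legendre_low n)) ?p_size// p0 !mul0r.
have := congr1 lead_coef qE; rewrite lead_coefZ /q lead_coef_comp ?s1X//.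
rewrite lead1X p_size /= [RHS]mulrC => /(mulfI (legendre_lead_neq0 n)) ->.
exact: qE.
Qed.

Lemma legendre_at0 n : (p n)`_0 = (-1) ^+ n.
Proof.
rewrite -horner_coef0; have := congr1 (fun q => q.[1]) (legendre_reflect n).
by rewrite horner_comp hornerZ p_at1 !hornerE subrr.
Qed.

(** The contribution of the triangle y < x: the integral over [0, 1] of
    x^s q(x) (B r)(x), where x^s (B r)(x) is the integral of
    (x - y)^(s-1) r(y) over [0, x]. *)
Definition half_pairing (s : K) (q r : {poly K}) : K :=
  moment (s + 1) (q * beta_op s r).

Lemma half_pairingZ (s c e : K) (q r : {poly K}) :
  half_pairing s (c *: q) (e *: r) = c * e * half_pairing s q r.
Proof.
by rewrite /half_pairing beta_opZ -scalerAl -scalerAr scalerA linearZ.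
Qed.

(** By the formulas for the coefficients of p_n and for the moments of
    p_(n+d), the j-th term of the pairing is, up to the sign (-1)^d, the j-th
    term of the Whipple sum with b = s + 1. *)
Lemma half_pairing_legendre s n d : (forall k : nat, s + k%:R != 0) ->
  pochhammer ((s + d%:R + 3) / 2) n != 0 ->
  half_pairing s (p (n + d)) (p n) =
  (-1) ^+ d * (pochhammer ((d%:R + 1 - s) / 2) n * pochhammer (- s) d
   / (s * (pochhammer ((s + d%:R + 3) / 2) n * pochhammer (s + 1) d.+1))).
Proof.
move=> hs hn0.
have hb k : (s + 1) - 1 + k%:R != 0 by rewrite addrK.
have e : half_pairing s (p (n + d)) (p n) =
    (-1) ^+ d * \sum_(j < n.+1) wzterm (s + 1) (n + d) n j.
  rewrite /half_pairing moment_mulE mulr_sumr.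
  have sb : (size (beta_op s (p n)) <= n.+1)%N.
    by rewrite (leq_trans (size_poly _ _))// p_size.
  rewrite (big_ord_widen n.+1
    (fun j => (beta_op s (p n))`_j * moment (s + 1 + j%:R) (p (n + d))) sb).
  rewrite big_mkcond; apply: eq_bigr => j _.
  transitivity ((beta_op s (p n))`_j * moment (s + 1 + j%:R) (p (n + d))).
    by case: ltnP => // /(nth_default 0) ->; rewrite mul0r.
  rewrite coef_poly p_size ltn_ord.
  have hsj k : s + 1 + j%:R + k%:R != 0.
    by have := hs (1 + j + k)%N; rewrite !natrD !addrA.
  rewrite (moment_orthogonal _ (@moment_legendre_low _)) ?p_size//.
  rewrite (coef_orthogonal j _ (@moment_legendre_low n)) ?p_size//.
  rewrite !legendre_at0 /wzterm /beta_coef addrK.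
  have j0 : j`!%:R != 0 :> K by rewrite pnatr_eq0 -lt0n fact_gt0.
  have -> : 1 - (s + 1 + j%:R) = 1 - (s + 1) - j%:R by rewrite opprD addrA.
  have h1 : pochhammer s j.+1 != 0 by exact: pochhammer_neq0.
  have h2 : pochhammer (s + 1 + j%:R) (n + d).+1 != 0 by exact: pochhammer_neq0.
  have <- : (-1) ^+ n * (-1) ^+ (n + d) = (-1) ^+ d :> K.
    by rewrite exprD mulrA -expr2 -exprM mulnC exprM sqrrN !expr1n mul1r.
  set x := (-1) ^+ n; set y := (-1) ^+ (n + d).
  by field; rewrite j0 h1 h2.
have := wzsum_closed hb n d.
have -> : (s + 1 + d%:R + 2) / 2 = (s + d%:R + 3) / 2 by congr (_ / _); ring.
have -> : (d%:R + 2 - (s + 1)) / 2 = (d%:R + 1 - s) / 2 by congr (_ / _); ring.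
rewrite e addrK => f; congr (_ * _); apply: (mulIf hn0); rewrite f.
have -> : 1 - (s + 1) = - s by ring.
have h1 : pochhammer (s + 1) d.+1 != 0.
  by apply: pochhammer_neq0 => k; have := hs k.+1; rewrite -natr1 addrAC addrA.
have h0 : s != 0 by have := hs 0%N; rewrite addr0.
by field; rewrite hn0 h1 h0.
Qed.

End LegendreSystem.

(** * The fundamental theorem of calculus with singular end points *)

Section ImproperFTC.
Variable R : realType.
Notation mu := (@lebesgue_measure R).
Implicit Types (f F : R -> R) (a b c : R).

(** f may be unbounded at a and b: integrability alone makes its indefinite
    integral G continuous, and F - G has zero derivative inside. *)
Lemma Rintegral_FTC2_oo f F a b : a <= b ->
  mu.-integrable `[a, b] (EFin \o f) ->
  {in `]a, b[, forall x, {for x, continuous f}} ->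
  continuous F ->
  (forall x, x \in `]a, b[ -> is_derive x 1 F (f x)) ->
  \int[mu]_(x in `[a, b]) f x = F b - F a.
Proof.
rewrite le_eqVlt => /predU1P[<- _ _ _ _|ab intf cf cF dF].
  by rewrite set_itv1 Rintegral_set1 subrr.
pose G x := \int[mu]_(t in `[a, x]) f t.
have dG x : x \in `]a, b[ -> is_derive x 1 (F - G) 0.
  move=> xab; have [ax xb] : a < x /\ x < b by move: xab; rewrite in_itv => /andP.
  have [G1 G2] := continuous_FTC1_closed xb intf ax (cf x xab).
  have dGx : is_derive x 1 G (f x).
    by apply: (DeriveDef G1); rewrite -derive1E G2.
  by rewrite -(subrr (f x)); have dFx := dF x xab; exact: is_deriveB.
have cG : {within `[a, b], continuous (F - G)}.
  apply: within_continuousB; first exact: continuous_subspaceT.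
  by apply: parameterized_integral_continuous => //; exact: ltW.
have [c _] := MVT ab dG cG.
rewrite mul0r !fctE /G set_itv1 Rintegral_set1 subr0 => h.
by apply/esym; move/eqP: h; rewrite subr_eq0 subr_eq addrC -subr_eq => /eqP.
Qed.

(** Exhaust ]a, b[ by compact intervals; by monotone convergence the integral
    is the limit of the increments of F, which is finite. *)
Lemma ge0_integrable_primitive f F a b : a < b ->
  {in `]a, b[, forall x, 0 <= f x} ->
  {in `]a, b[, forall x, {for x, continuous f}} ->
  continuous F ->
  (forall x, x \in `]a, b[ -> is_derive x 1 F (f x)) ->
  mu.-integrable `[a, b] (EFin \o f).
Proof.
move=> ab f0 cf cF dF.
have mf : measurable_fun `]a, b[ f.
  apply: open_continuous_measurable_fun.
    exact: interval_open.
  by move=> x /[1!inE]; exact: cf.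
apply/integrableP; split.
  apply/measurable_EFinP; apply: measurable_fun_itv_cc mf.
rewrite integral_itv_bndoo; last first.
  by apply: measurableT_comp => //; apply/measurable_EFinP.
(* the shift by 3 keeps a + e n < b - e n from n = 0 on *)
pose e n := (b - a) / n.+3%:R.
have ba0 : 0 < b - a by rewrite subr_gt0.
have e0 n : 0 < e n by rewrite divr_gt0.
have e_lt n : a + e n < b - e n.
  have e3 : e n <= (b - a) / 3.
    by rewrite ler_pM2l// lef_pV2 ?posrE// ler_nat.
  lra.
have e_cvg : e @ \oo --> 0.
  have -> : e = (fun n => (b - a) * harmonic (n + 2)%N).
    by apply/funext => n; rewrite /e /= addn2.
  rewrite -(mulr0 (b - a)); apply: cvgM; first exact: cvg_cst.
  have /= := @cvg_harmonic R; rewrite -(cvg_shiftn 2); exact.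
pose S n := `[a + e n, b - e n]%classic.
have SE : `]a, b[%classic = \bigcup_n S n.
  apply/seteqP; split => [x|x [n _]]; rewrite /S /= !in_itv/=.
    move=> /andP[ax xb].
    have : \forall n \near \oo, e n < Num.min (x - a) (b - x).
      by apply: (cvgr_lt 0) => //; rewrite lt_min !subr_gt0 ax xb.
    move=> [n _ /(_ n (leqnn n))]; rewrite lt_min => /andP[h1 h2].
    by exists n => //=; rewrite in_itv/=; apply/andP; split; lra.
  by move=> /andP[h1 h2]; have := e0 n; move=> h0; apply/andP; split; lra.
have Soo n x : S n x -> x \in `]a, b[.
  by move=> Sx; have : `]a, b[%classic x by rewrite SE; exists n.
have ndS : nondecreasing_seq S.
  apply/nondecreasing_seqP => n; rewrite subsetEset => x; rewrite /S /= !in_itv/=.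
  have : e n.+1 <= e n by rewrite ler_pM2l// lef_pV2 ?posrE// ler_nat.
  by move=> h /andP[h1 h2]; apply/andP; split; lra.
have mS n : measurable (S n) by exact: measurable_itv.
have FS n : (\int[mu]_(x in S n) `|(f x)%:E| = (F (b - e n) - F (a + e n))%:E)%E.
  have -> : (\int[mu]_(x in S n) `|(f x)%:E| = \int[mu]_(x in S n) (f x)%:E)%E.
    apply: eq_integral => x /[1!inE] /Soo xab.
    by rewrite gee0_abs// lee_fin f0.
  rewrite (continuous_FTC2 (e_lt n) (F := F)) ?EFinB//.
  - apply: continuous_in_subspaceT => x /[1!inE] /Soo xab; exact: cf.
  - split.
    + move=> x xS; have xab : x \in `]a, b[.
        by apply: (Soo n); apply: subset_itv_oo_cc.
      by have := dF x xab; move=> /@ex_derive.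
    + exact/cvg_at_right_filter/cF.
    + exact/cvg_at_left_filter/cF.
  - move=> x xS; have xab : x \in `]a, b[.
      by apply: (Soo n); apply: subset_itv_oo_cc.
    by rewrite derive1E; have := dF x xab; move=> /@derive_val.
have lim2 : (\int[mu]_(x in S n) `|(f x)%:E|)%E @[n --> \oo] --> (F b - F a)%:E.
  under eq_fun do rewrite FS.
  apply: cvg_EFin; first exact: nearW.
  have eb : (fun n => b - e n) @ \oo --> b.
    by rewrite -[X in _ --> X]subr0; apply: cvgB => //; exact: cvg_cst.
  have ea : (fun n => a + e n) @ \oo --> a.
    by rewrite -[X in _ --> X]addr0; apply: cvgD => //; exact: cvg_cst.
  by apply: cvgB; [apply: (cvg_comp _ _ eb (cF b))|apply: (cvg_comp _ _ ea (cF a))].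
have h : (\int[mu]_(x in S n) `|(f x)%:E|)%E @[n --> \oo] -->
    (\int[mu]_(x in `]a, b[) `|(f x)%:E|)%E.
  rewrite SE; apply: ge0_nondecreasing_set_cvg_integral => // n.
  apply: measurableT_comp => //; apply/measurable_EFinP.
  by apply: measurable_funS mf => // x /Soo.
by rewrite (cvg_unique _ h lim2)// ltry.
Qed.

End ImproperFTC.

(** * Calculus of complex-valued functions of a real variable *)

Section ComplexCalculus.
Variable R : realType.
Notation C := R[i].
Notation Re := complex.Re.
Notation Im := complex.Im.
Implicit Types (F G : R -> C) (x t : R) (z w : C).

Lemma Re_add z w : Re (z + w) = Re z + Re w. Proof. by case: z; case: w. Qed.
Lemma Im_add z w : Im (z + w) = Im z + Im w. Proof. by case: z; case: w. Qed.
Lemma Re_mul z w : Re (z * w) = Re z * Re w - Im z * Im w.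
Proof. by case: z; case: w. Qed.
Lemma Im_mul z w : Im (z * w) = Re z * Im w + Im z * Re w.
Proof. by case: z => a b; case: w => c d /=; rewrite addrC. Qed.

Lemma complexP z w : Re z = Re w -> Im z = Im w -> z = w.
Proof. by case: z => a b; case: w => c d /= -> ->. Qed.

Definition is_cderive F x (dF : C) :=
  is_derive x 1 (fun t => Re (F t)) (Re dF) /\
  is_derive x 1 (fun t => Im (F t)) (Im dF).

Definition ccontinuous_at F x :=
  {for x, continuous (fun t => Re (F t))} /\ {for x, continuous (fun t => Im (F t))}.

Lemma is_cderive_continuous F x dF : is_cderive F x dF -> ccontinuous_at F x.
Proof.
by move=> [[d1 _] [d2 _]]; split; apply: differentiable_continuous;
  apply/derivable1_diffP.
Qed.

Lemma is_cderive_cst z x : is_cderive (fun=> z) x 0.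
Proof. by split; exact: is_derive_cst. Qed.

Lemma is_cderive_real x : is_cderive (fun t => t%:C) x 1.
Proof. by split; [exact: is_derive_id|exact: is_derive_cst]. Qed.

Lemma is_cderiveD F G x dF dG : is_cderive F x dF -> is_cderive G x dG ->
  is_cderive (fun t => F t + G t) x (dF + dG).
Proof.
move=> [F1 F2] [G1 G2]; split.
- rewrite (_ : (fun t => _) = (fun t => Re (F t)) + (fun t => Re (G t))).
    by rewrite Re_add; exact: is_deriveD.
  by apply/funext => t; rewrite Re_add.
- rewrite (_ : (fun t => _) = (fun t => Im (F t)) + (fun t => Im (G t))).
    by rewrite Im_add; exact: is_deriveD.
  by apply/funext => t; rewrite Im_add.
Qed.

Lemma is_cderiveM F G x dF dG : is_cderive F x dF -> is_cderive G x dG ->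
  is_cderive (fun t => F t * G t) x (dF * G x + F x * dG).
Proof.
move=> [F1 F2] [G1 G2]; split.
- rewrite (_ : (fun t => _) = (fun t => Re (F t)) * (fun t => Re (G t))
     - (fun t => Im (F t)) * (fun t => Im (G t))); last first.
    by apply/funext => t; rewrite Re_mul.
  apply: (is_derive_eq (is_deriveB (is_deriveM F1 G1) (is_deriveM F2 G2))).
  by rewrite Re_add !Re_mul /GRing.scale /=; ring.
- rewrite (_ : (fun t => _) = (fun t => Re (F t)) * (fun t => Im (G t))
     + (fun t => Im (F t)) * (fun t => Re (G t))); last first.
    by apply/funext => t; rewrite Im_mul.
  apply: (is_derive_eq (is_deriveD (is_deriveM F1 G2) (is_deriveM F2 G1))).
  by rewrite Im_add !Im_mul /GRing.scale /=; ring.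
Qed.

Lemma is_cderive_comp F (g : R -> R) x dF dg :
  is_cderive F (g x) dF -> is_derive x 1 g dg ->
  is_cderive (fun t => F (g t)) x (dF * dg%:C).
Proof.
move=> [F1 F2] dg1; split.
- apply: (is_derive_eq (is_derive1_comp F1 dg1)).
  by rewrite Re_mul /= mulr0 subr0.
- apply: (is_derive_eq (is_derive1_comp F2 dg1)).
  by rewrite Im_mul /= mulr0 add0r.
Qed.

Lemma is_cderive_horner (Q : {poly C}) x :
  is_cderive (fun t => Q.[t%:C]) x (Q^`()).[x%:C].
Proof.
elim/poly_ind: Q => [|Q c IH].
  rewrite deriv0 horner0 (_ : (fun t => _) = fun=> 0); first exact: is_cderive_cst.
  by apply/funext => t; rewrite horner0.
rewrite (_ : (fun t => _) = fun t => Q.[t%:C] * t%:C + c); last first.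
  by apply/funext => t; rewrite hornerMXaddC.
rewrite derivD derivM derivX derivC addr0 mulr1 hornerD hornerM hornerX.
have := is_cderiveD (is_cderiveM IH (is_cderive_real x)) (is_cderive_cst c x).
by rewrite addr0 mulr1.
Qed.

Lemma Re_cpow t (al : C) :
  Re (cpow t al) = expR (Re al * ln t) * cos (Im al * ln t).
Proof.
by rewrite /cpow /cexp Re_mul Re_mul Im_mul /= !mulr0 mul0r add0r !subr0.
Qed.

Lemma Im_cpow t (al : C) :
  Im (cpow t al) = expR (Re al * ln t) * sin (Im al * ln t).
Proof.
by rewrite /cpow /cexp Im_mul Re_mul Im_mul /= !mulr0 mul0r add0r subr0 addr0.
Qed.

Lemma is_cderive_cpow (al : C) t : 0 < t ->
  is_cderive (fun t => cpow t al) t (al * cpow t al * (t^-1)%:C).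
Proof.
move=> t0; have dl := is_derive1_ln t0.
have lin (k : R) : is_derive t 1 (fun t => k * ln t) (k * t^-1).
  have := is_deriveZ k dl; exact.
have dE := @is_derive1_comp _ expR (fun t => Re al * ln t) t _ _
  (is_derive_expR (Re al * ln t)) (lin (Re al)).
have dC := @is_derive1_comp _ cos (fun t => Im al * ln t) t _ _
  (is_derive_cos (Im al * ln t)) (lin (Im al)).
have dS := @is_derive1_comp _ sin (fun t => Im al * ln t) t _ _
  (is_derive_sin (Im al * ln t)) (lin (Im al)).
split.
- rewrite (_ : (fun t => _) = (expR \o (fun t => Re al * ln t)) *
     (cos \o (fun t => Im al * ln t))); last first.
    by apply/funext => u; rewrite Re_cpow.
  apply: (is_derive_eq (is_deriveM dE dC)).
  rewrite (Re_mul (al * _)) (Re_mul al) (Im_mul al) Re_cpow Im_cpow.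
  by rewrite /GRing.scale /=; ring.
- rewrite (_ : (fun t => _) = (expR \o (fun t => Re al * ln t)) *
     (sin \o (fun t => Im al * ln t))); last first.
    by apply/funext => u; rewrite Im_cpow.
  apply: (is_derive_eq (is_deriveM dE dS)).
  rewrite (Im_mul (al * _)) (Re_mul al) (Im_mul al) Re_cpow Im_cpow.
  by rewrite /GRing.scale /=; ring.
Qed.

Lemma ccontinuous_comp F (g : R -> R) x : continuous g ->
  ccontinuous_at F (g x) -> ccontinuous_at (fun t => F (g t)) x.
Proof.
move=> cg [F1 F2]; split.
- exact: (@continuous_comp _ _ _ g (fun t : R => Re (F t)) x (cg x) F1).
- exact: (@continuous_comp _ _ _ g (fun t : R => Im (F t)) x (cg x) F2).
Qed.

Lemma ccontinuousM F G x : ccontinuous_at F x -> ccontinuous_at G x ->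
  ccontinuous_at (fun t => F t * G t) x.
Proof.
move=> [F1 F2] [G1 G2]; split.
- rewrite (_ : (fun t => _) = (fun t => Re (F t) * Re (G t) - Im (F t) * Im (G t))).
    exact: (continuousB (continuousM F1 G1) (continuousM F2 G2)).
  by apply/funext => t; rewrite Re_mul.
- rewrite (_ : (fun t => _) = (fun t => Re (F t) * Im (G t) + Im (F t) * Re (G t))).
    exact: (continuousD (continuousM F1 G2) (continuousM F2 G1)).
  by apply/funext => t; rewrite Im_mul.
Qed.

(** The factor t compensates the singularity of t^a at 0, since t^(a+1) -> 0.
    As ln vanishes on t <= 0, the function is linear there, so that continuity
    holds on the whole line and no one-sided limits are needed.  The function
    h stands for cos and sin. *)
Lemma continuous_tamed_power (a b : R) (h : R -> R) : -1 < a ->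
  continuous h -> (forall u, `|h u| <= 1) ->
  continuous (fun t : R => expR (a * ln t) * h (b * ln t) * t).
Proof.
move=> a1 ch h1 x; have [x0|x0|->] := ltgtP x 0.
- have e : {near x, (fun t : R => h 0 * t) =1
      (fun t : R => expR (a * ln t) * h (b * ln t) * t)}.
    near=> t; have t0 : t < 0 by near: t; exact: lt_nbhsl.
    by rewrite ln0 ?ltW// !mulr0 expR0 mul1r.
  apply: (cvg_trans (near_eq_cvg e)).
  rewrite ln0 ?ltW// !mulr0 expR0 mul1r.
  have e2 : {for x, continuous (cst (h 0) \* id)}.
    by apply: continuousM; [exact: cst_continuous|exact: cvg_id].
  exact: e2.
- have cl := continuous_ln x0.
  have ck (k : R) : {for x, continuous (fun t : R => k * ln t)}.
    by apply: cvgM; [exact: cvg_cst|exact: cl].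
  apply: cvgM; last exact: cvg_id.
  apply: cvgM.
    by apply: continuous_comp; [exact: ck|exact: continuous_expR].
  by apply: continuous_comp; [exact: ck|exact: ch].
- have near_small (e : R) : 0 < e -> \forall t \near (0 : R), `|t| < e.
    by move=> e0; exists e => //= y /=; rewrite sub0r normrN.
  rewrite /continuous_at mulr0; apply/cvgrPdist_lt => e e0; near=> t.
  rewrite sub0r normrN normrM.
  apply: (@le_lt_trans _ _ (expR (a * ln t) * `|t|)).
    rewrite ler_wpM2r// normrM ger0_norm ?expR_ge0// -[leRHS]mulr1.
    by rewrite ler_wpM2l ?expR_ge0.
  have [t0|t0] := leP t 0.
    rewrite ln0// mulr0 expR0 mul1r.
    by near: t; exact: near_small.
  rewrite gtr0_norm// -[X in _ * X](lnK t0) -expRD.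
  rewrite -[ltRHS](lnK e0) ltr_expR -[X in _ + X]mul1r -mulrDl mulrC.
  rewrite -ltr_pdivlMr; last lra.
  rewrite -ltr_expR lnK// (le_lt_trans (ler_norm t))//.
  by near: t; apply: near_small; exact: expR_gt0.
Unshelve. all: by end_near. Qed.

Lemma is_derive_affine (sg tau x : R) :
  is_derive x 1 (fun y : R => sg * y + tau) sg.
Proof.
have := is_deriveD (is_deriveZ sg (is_derive_id x 1)) (is_derive_cst tau x 1).
by rewrite addr0 /GRing.scale /= mulr1; exact.
Qed.

Lemma continuous_affine (sg tau : R) : continuous (fun y : R => sg * y + tau).
Proof.
move=> y; have [h _] := is_derive_affine sg tau y.
by apply: differentiable_continuous; apply/derivable1_diffP.
Qed.

Lemma ccontinuous_tamed_cpow (al : C) x : -1 < Re al ->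
  ccontinuous_at (fun t => cpow t al * t%:C) x.
Proof.
move=> a1; split.
- rewrite (_ : (fun t => _) =
      (fun t => expR (Re al * ln t) * cos (Im al * ln t) * t)).
    by apply: continuous_tamed_power => //; [exact: continuous_cos|exact: cos_max].
  by apply/funext => t; rewrite Re_mul Re_cpow /= mulr0 subr0.
- rewrite (_ : (fun t => _) =
      (fun t => expR (Re al * ln t) * sin (Im al * ln t) * t)).
    by apply: continuous_tamed_power => //; [exact: continuous_sin|exact: sin_max].
  by apply/funext => t; rewrite Im_mul Im_cpow /= mulr0 add0r.
Qed.

End ComplexCalculus.

(** * Measurability and integrability of complex-valued functions *)

Section ComplexIntegrals.
Context d (T : measurableType d) (R : realType) (nu : {measure set T -> \bar R}).
Notation Re := complex.Re.
Notation Im := complex.Im.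
Implicit Types (D : set T) (f g : T -> R[i]).

Lemma eq_cintegral D f g : {in D, f =1 g} ->
  cintegral nu D f = cintegral nu D g.
Proof. by move=> fg; congr (_ +i* _); apply: eq_Rintegral => x /fg ->. Qed.

Lemma eq_cintegrable D f g : measurable D -> {in D, f =1 g} ->
  cintegrable nu D f -> cintegrable nu D g.
Proof.
move=> mD fg [f1 f2]; split.
- by apply: eq_integrable f1 => // x /fg ->.
- by apply: eq_integrable f2 => // x /fg ->.
Qed.

Definition cmeasurable (f : T -> R[i]) :=
  measurable_fun setT (fun x => Re (f x)) /\
  measurable_fun setT (fun x => Im (f x)).

Lemma cmeasurableM f g : cmeasurable f -> cmeasurable g ->
  cmeasurable (fun x => f x * g x).
Proof.
move=> [f1 f2] [g1 g2]; split.
- under eq_fun do rewrite Re_mul.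
  by apply: measurable_funB; exact: measurable_funM.
- under eq_fun do rewrite Im_mul.
  by apply: measurable_funD; exact: measurable_funM.
Qed.

Lemma normc_Re_le (z : R[i]) (r : R) : `|z| <= r%:C -> `|Re z| <= r.
Proof. by move=> /(le_trans (normc_ge_Re z)); rewrite lecR. Qed.

Lemma normc_Im_le (z : R[i]) (r : R) : `|z| <= r%:C -> `|Im z| <= r.
Proof.
move=> zr; have -> : Im z = Re (- 'i * z).
  by rewrite Re_mul /= oppr0 mul0r sub0r mulN1r opprK.
apply: normc_Re_le; rewrite normrM normrN.
suff -> : `|'i : R[i]| = 1 by rewrite mul1r.
by rewrite normc_def /= expr0n /= add0r expr1n sqrtr1.
Qed.

Lemma cintegrable_dominated D f (g : T -> R) : measurable D ->
  cmeasurable f ->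
  nu.-integrable D (EFin \o g) -> (forall x, D x -> `|f x| <= (g x)%:C) ->
  cintegrable nu D f.
Proof.
move=> mD [mRe mIm] ig fg; split.
- apply: le_integrable ig => //; first exact/measurable_EFinP/measurable_funTS.
  move=> x /fg /normc_Re_le h /=; rewrite lee_fin (le_trans h)// ler_norm//.
- apply: le_integrable ig => //; first exact/measurable_EFinP/measurable_funTS.
  move=> x /fg /normc_Im_le h /=; rewrite lee_fin (le_trans h)// ler_norm//.
Qed.

Lemma cintegralD D f g : measurable D -> cintegrable nu D f -> cintegrable nu D g ->
  cintegral nu D (fun x => f x + g x) = cintegral nu D f + cintegral nu D g.
Proof.
move=> mD [f1 f2] [g1 g2]; rewrite /cintegral.
under eq_Rintegral do rewrite Re_add.
under [X in _ +i* X]eq_Rintegral do rewrite Im_add.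
by rewrite !RintegralD.
Qed.

Lemma integrableU (A B : set T) (h : T -> \bar R) : measurable A -> measurable B ->
  [disjoint A & B] -> nu.-integrable A h -> nu.-integrable B h ->
  nu.-integrable (A `|` B) h.
Proof.
move=> mA mB dAB /integrableP[mhA hA] /integrableP[mhB hB]; apply/integrableP.
have mh : measurable_fun (A `|` B) h by apply/measurable_funU.
split=> //; rewrite ge0_integral_setU//; first exact: lte_add_pinfty.
exact: measurableT_comp.
Qed.

End ComplexIntegrals.

Lemma cmeasurable_comp d1 d2 (T1 : measurableType d1) (T2 : measurableType d2)
    (R : realType) (f : T2 -> R[i]) (g : T1 -> T2) :
  cmeasurable f -> measurable_fun setT g -> cmeasurable (fun x => f (g x)).
Proof.
by move=> [f1 f2] mg; split; [exact: (measurableT_comp f1)|exact: (measurableT_comp f2)].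
Qed.

(** * Integrals of complex powers *)

Section PowerIntegrals.
Variable R : realType.
Notation C := R[i].
Notation Re := complex.Re.
Notation Im := complex.Im.
Notation mu := (@lebesgue_measure R).

Lemma normc_real (x : R) : `|x%:C| = `|x|%:C.
Proof. by rewrite normc_def /= expr0n /= addr0 sqrtr_sqr. Qed.

Lemma cintegral_FTC2 (f F : R -> C) a b : a <= b ->
  cintegrable mu `[a, b] f ->
  {in `]a, b[, forall x, ccontinuous_at f x} ->
  (forall x, ccontinuous_at F x) ->
  (forall x, x \in `]a, b[ -> is_cderive F x (f x)) ->
  cintegral mu `[a, b] f = F b - F a.
Proof.
move=> ab [f1 f2] cf cF dF; apply: complexP => /=.
- rewrite Re_add (_ : Re (- F a) = - Re (F a)); last by case: (F a).
  apply: (@Rintegral_FTC2_oo _ _ (fun t => Re (F t)) _ _ ab f1)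
    => [x /cf[]//|x|x /dF[]//].
  by have [] := cF x.
- rewrite Im_add (_ : Im (- F a) = - Im (F a)); last by case: (F a).
  apply: (@Rintegral_FTC2_oo _ _ (fun t => Im (F t)) _ _ ab f2)
    => [x /cf[]//|x|x /dF[]//].
  by have [] := cF x.
Qed.

Lemma horner_bounded (K : numDomainType) (Q : {poly K}) (c : K) :
  exists M : K, forall x, `|x| <= c -> `|Q.[x]| <= M.
Proof.
elim/poly_ind: Q => [|Q k [M IH]].
  by exists 0 => x _; rewrite horner0 normr0.
exists (M * c + `|k|) => x xc; rewrite hornerMXaddC (le_trans (ler_normD _ _))//.
by rewrite lerD2r normrM ler_pM// IH.
Qed.

Lemma normc_cpow (t : R) (al : C) : `|cpow t al| = (expR (Re al * ln t))%:C.
Proof.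
rewrite normc_def Re_cpow Im_cpow !exprMn -mulrDr cos2Dsin2 mulr1.
by rewrite sqrtr_sqr ger0_norm ?expR_ge0.
Qed.

Lemma cmeasurable_cpow (al : C) : cmeasurable (fun t : R => cpow t al).
Proof.
have mln (k : R) : measurable_fun setT (fun t : R => k * ln t).
  by apply: measurable_funM; [exact: measurable_cst|exact: measurable_ln].
have mexp : measurable_fun setT (fun t : R => expR (Re al * ln t)).
  exact: (measurableT_comp (@measurable_expR R) (mln (Re al))).
split.
- under eq_fun do rewrite Re_cpow.
  apply: measurable_funM => //.
  exact: (measurableT_comp (continuous_measurable_fun (@continuous_cos R)) (mln _)).
- under eq_fun do rewrite Im_cpow.
  apply: measurable_funM => //.
  exact: (measurableT_comp (continuous_measurable_fun (@continuous_sin R)) (mln _)).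
Qed.

Lemma cmeasurable_horner (Q : {poly C}) : cmeasurable (fun t : R => Q.[t%:C]).
Proof.
by split; apply: continuous_measurable_fun => t;
  have [] := is_cderive_continuous (is_cderive_horner Q t).
Qed.

Variable al : C.
Hypothesis al_gt : -1 < Re al.

Lemma al_shift_neq0 (k : nat) : al + 1 + k%:R != 0.
Proof.
apply/negP => /eqP/(congr1 (@complex.Re R)); rewrite !Re_add /= => h.
have k0 : 0 <= k%:R :> R by [].
have kE : Re (k%:R : C) = k%:R by rewrite -(rmorph_nat (real_complex R)).
rewrite kE in h.
have al1 : 0 < Re al + 1 by rewrite -ltrBlDr sub0r.
by have := ltr_wpDr k0 al1; rewrite h ltxx.
Qed.

(** An antiderivative of t^al Q(t) on t > 0 which is continuous at 0. *)
Definition cprim (Q : {poly C}) (t : R) : C :=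
  cpow t al * t%:C * (mprim (al + 1) Q).[t%:C].

Lemma cprim0 Q : cprim Q 0 = 0.
Proof. by rewrite /cprim mulr0 mul0r. Qed.

Lemma cprim_continuous Q t : ccontinuous_at (cprim Q) t.
Proof.
apply: ccontinuousM; first exact: ccontinuous_tamed_cpow.
exact: (is_cderive_continuous (is_cderive_horner _ _)).
Qed.

Lemma cprim_derive Q t : 0 < t ->
  is_cderive (cprim Q) t (cpow t al * Q.[t%:C]).
Proof.
move=> t0.
have -> : cprim Q = (fun t => cpow t al * ('X * mprim (al + 1) Q).[t%:C]).
  by apply/funext => u; rewrite /cprim hornerM hornerX mulrA.
have := is_cderiveM (is_cderive_cpow al t0) (is_cderive_horner ('X * mprim (al + 1) Q) t).
congr is_cderive.
rewrite -[in RHS](mprim_ode Q al_shift_neq0) addrK hornerD hornerZ hornerM hornerX.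
rewrite fmorphV; have t0' : t%:C != 0 by rewrite fmorph_eq0 gt_eqF.
by field.
Qed.

(** The modulus of t^al is integrable up to t = 0, for t = sg * y + tau with
    sg = 1 (singular point on the left) or sg = -1 (on the right). *)
Lemma real_power_integrable (sg tau a b : R) : sg ^+ 2 = 1 -> a <= b ->
  {in `]a, b[, forall y, 0 < sg * y + tau} ->
  mu.-integrable `[a, b] (EFin \o (fun y => expR (Re al * ln (sg * y + tau)))).
Proof.
move=> sg2; rewrite le_eqVlt => /predU1P[<- _|ab pos].
  by rewrite set_itv1; apply: null_set_integrable => //;
    [exact: measurable_fun_set1|exact: lebesgue_measure_set1].
set e := Re al.
have e1 : 0 < e + 1 by rewrite -ltrBlDr sub0r.
have cE : continuous (fun t : R => expR (e * ln t) * t).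
  have := @continuous_tamed_power R e 0 (fun=> 1) al_gt (fun x => cvg_cst (1 : R)).
  rewrite (_ : (fun t => _) = (fun t : R => expR (e * ln t) * t)).
    by apply=> u; rewrite normr1.
  by apply/funext => t; rewrite mulr1.
(* since 1 / sg = sg, this is an antiderivative for either sign *)
pose F y := sg / (e + 1) * (expR (e * ln (sg * y + tau)) * (sg * y + tau)).
apply: (@ge0_integrable_primitive _ _ F _ _ ab).
- by move=> y _; exact: expR_ge0.
- move=> y yab; have cl := continuous_ln (pos y yab).
  apply: continuous_comp; last exact: continuous_expR.
  apply: cvgM; first exact: cvg_cst.
  by apply: (@continuous_comp _ _ _ (fun y => sg * y + tau) (@ln R));
    [exact: continuous_affine|exact: cl].
- move=> y; apply: cvgM; first exact: cvg_cst.
  exact: (@continuous_comp _ _ _ (fun y : R => sg * y + tau)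
    (fun t : R => expR (e * ln t) * t) y (@continuous_affine _ sg tau y) (cE _)).
- move=> y yab; have t0 := pos y yab; set t := sg * y + tau in t0.
  have dl := is_deriveZ e (is_derive1_ln t0).
  have dE := @is_derive1_comp _ expR (e \*: @ln R) t _ _ (is_derive_expR _) dl.
  have dEt := is_deriveM dE (is_derive_id t 1).
  have dF := is_deriveZ (sg / (e + 1))
    (@is_derive1_comp _ _ (fun y => sg * y + tau) y _ _ dEt (is_derive_affine sg tau y)).
  apply: (is_derive_eq dF).
  rewrite /GRing.scale /= -/t.
  have t0' : t != 0 by rewrite gt_eqF.
  have e1' : e + 1 != 0 by rewrite gt_eqF.
  transitivity (sg ^+ 2 * expR (e * ln t)); last by rewrite sg2 mul1r.
  by field; rewrite t0' e1'.
Qed.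

Lemma measurable_affine (sg tau : R) : measurable_fun setT (fun y : R => sg * y + tau).
Proof. by apply: measurable_funD => //; exact: measurable_funM. Qed.

Lemma cintegral_cpow_affine (Q : {poly C}) (sg tau a b : R) : sg ^+ 2 = 1 -> a <= b ->
  {in `]a, b[, forall y, 0 < sg * y + tau} ->
  cintegrable mu `[a, b]
    (fun y => cpow (sg * y + tau) al * Q.[(sg * y + tau)%:C]) /\
  cintegral mu `[a, b]
    (fun y => cpow (sg * y + tau) al * Q.[(sg * y + tau)%:C]) =
  sg%:C * (cprim Q (sg * b + tau) - cprim Q (sg * a + tau)).
Proof.
move=> sg2 ab pos.
set f := fun y : R => cpow (sg * y + tau) al * Q.[(sg * y + tau)%:C].
have intf : cintegrable mu `[a, b] f.
  pose c := `|a| + `|b| + `|tau|.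
  have [M HM] := horner_bounded Q c%:C.
  have mf : cmeasurable f.
    have ma := measurable_affine sg tau.
    apply: cmeasurableM; first exact: (cmeasurable_comp (cmeasurable_cpow al) ma).
    exact: (cmeasurable_comp (cmeasurable_horner Q) ma).
  apply: (@cintegrable_dominated _ _ _ mu `[a, b] f
    (fun y => Re M * expR (Re al * ln (sg * y + tau)))) => //.
  - exact: (integrableZl _ (Re M) (real_power_integrable sg2 ab pos)).
  - move=> y yab; rewrite normrM normc_cpow mulrC rmorphM /=.
    rewrite ler_wpM2r ?ler0c ?expR_ge0//.
    have /HM QM : `|(sg * y + tau)%:C| <= c%:C.
      rewrite normc_real lecR (le_trans (ler_normD _ _))// lerD2r normrM.
      have -> : `|sg| = 1.
        apply/eqP; rewrite -[_ == _](@eqrXn2 _ 2)//.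
        by rewrite real_normK ?num_real// sg2 expr1n.
      rewrite mul1r ler_norml; move: yab; rewrite /= in_itv/= => /andP[ay yb].
      have := ler_norm b; have := ler_norm (- a); rewrite normrN.
      have := normr_ge0 a; have := normr_ge0 b.
      by move=> *; apply/andP; split; lra.
    rewrite (le_trans QM)// RRe_real//.
    by rewrite ger0_real// (le_trans _ QM).
split=> //.
pose F y := sg%:C * cprim Q (sg * y + tau).
have := @cintegral_FTC2 f F a b ab intf _ _ _; rewrite /F -mulrBr; apply.
- move=> y yab.
  apply: (@ccontinuous_comp _ (fun t => cpow t al * Q.[t%:C]) _ y
    (@continuous_affine _ sg tau)).
  apply: ccontinuousM.
    exact: (is_cderive_continuous (is_cderive_cpow al (pos y yab))).
  exact: (is_cderive_continuous (is_cderive_horner Q _)).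
- move=> y; apply: ccontinuousM.
    exact: (is_cderive_continuous (is_cderive_cst _ _)).
  apply: (@ccontinuous_comp _ (cprim Q) _ y (@continuous_affine _ sg tau)).
  exact: cprim_continuous.
- move=> y yab.
  have := is_cderiveM (is_cderive_cst sg%:C y)
    (@is_cderive_comp _ (cprim Q) (fun y => sg * y + tau) y _ _
      (cprim_derive Q (pos y yab)) (is_derive_affine sg tau y)).
  by congr is_cderive; rewrite mul0r add0r mulrCA -rmorphM /= -expr2 sg2 mulr1.
Qed.

(** The singular point x splits [0, 1]; on either side the integrand is a power
    of the distance t to x times q, expanded as a polynomial in t. *)
Lemma cintegral_cpow_dist (q : {poly C}) (x : R) : 0 <= x <= 1 ->
  cintegrable mu `[0, 1] (fun y => cpow `|x - y| al * q.[y%:C]) /\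
  cintegral mu `[0, 1] (fun y => cpow `|x - y| al * q.[y%:C]) =
  cprim (q \Po (x%:C%:P - 'X)) x + cprim (q \Po (x%:C%:P + 'X)) (1 - x).
Proof.
move=> /andP[x0 x1]; set f := fun y : R => cpow `|x - y| al * q.[y%:C].
have [L1 L2] : cintegrable mu `[0, x] f /\
    cintegral mu `[0, x] f = cprim (q \Po (x%:C%:P - 'X)) x.
  have [] := @cintegral_cpow_affine (q \Po (x%:C%:P - 'X)) (-1) x 0 x _ x0 _.
  - by rewrite sqrrN expr1n.
  - by move=> y; rewrite in_itv/= => /andP[_ yx]; rewrite mulN1r addrC subr_gt0.
  set g := (fun y : R => cpow (-1 * y + x) al * _) => ig eg.
  have gf : {in `[0, x]%classic, g =1 f}.
    move=> y; rewrite inE/= in_itv/= => /andP[_ yx].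
    rewrite /g /f mulN1r [- y + x]addrC ger0_norm ?subr_ge0//.
    by rewrite horner_comp hornerD hornerN hornerX hornerC -rmorphB /= subKr.
  split; first by apply: (@eq_cintegrable _ _ _ mu _ g) => //; exact: gf.
  rewrite -(@eq_cintegral _ _ _ mu _ g f gf) eg mulr0 add0r mulN1r addNr cprim0 sub0r.
  by rewrite rmorphN mulN1r opprK.
have [R1 R2] : cintegrable mu `[x, 1] f /\
    cintegral mu `[x, 1] f = cprim (q \Po (x%:C%:P + 'X)) (1 - x).
  have [] := @cintegral_cpow_affine (q \Po (x%:C%:P + 'X)) 1 (- x) x 1 _ x1 _.
  - by rewrite expr1n.
  - by move=> y; rewrite in_itv/= => /andP[xy _]; rewrite mul1r subr_gt0.
  set g := (fun y : R => cpow (1 * y - x) al * _) => ig eg.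
  have gf : {in `[x, 1]%classic, g =1 f}.
    move=> y; rewrite inE/= in_itv/= => /andP[xy _].
    rewrite /g /f mul1r distrC ger0_norm ?subr_ge0//.
    by rewrite horner_comp hornerD hornerX hornerC -rmorphD /= [x + _]addrC subrK.
  split; first by apply: (@eq_cintegrable _ _ _ mu _ g) => //; exact: gf.
  by rewrite -(@eq_cintegral _ _ _ mu _ g f gf) eg !mul1r subrr cprim0 subr0.
have intf : cintegrable mu `[0, 1] f.
  have UE : `[0, 1]%classic = `[0, x]%classic `|` `]x, 1]%classic.
    by apply: itv_bndbnd_setU; rewrite bnd_simp.
  have d01 : [disjoint `[0, x]%classic & `]x, 1]%classic].
    apply/disj_setPS => y [] /=; rewrite !in_itv/= => /andP[_ yx] /andP[xy _].
    by have := lt_le_trans xy yx; rewrite ltxx.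
  have sub : `]x, 1] `<=` `[x, 1] by exact: subset_itv_oc_cc.
  have [L1a L1b] := L1; have [R1a R1b] := R1.
  rewrite UE; split; apply: integrableU => //.
    by apply: integrableS R1a.
  by apply: integrableS R1b.
split=> //; rewrite -L2 -R2.
have [I1 I2] := intf; have [R1a R1b] := R1.
have sub : `]x, 1] `<=` `[x, 1] by exact: subset_itv_oc_cc.
apply: complexP.
- rewrite Re_add /= -(@Rintegral_itv_obnd_cbnd _ x (BRight 1)); last first.
    by apply: integrableS R1a.
  by rewrite -(@Rintegral_itvB _ _ (BLeft 0) (BRight 1) x)// addrC subrK.
- rewrite Im_add /= -(@Rintegral_itv_obnd_cbnd _ x (BRight 1)); last first.
    by apply: integrableS R1b.
  by rewrite -(@Rintegral_itvB _ _ (BLeft 0) (BRight 1) x)// addrC subrK.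
Qed.

End PowerIntegrals.

(** * The double integral *)

Section DoubleIntegral.
Variable R : realType.
Notation C := R[i].
Notation Re := complex.Re.
Notation Im := complex.Im.
Notation mu := (@lebesgue_measure R).
Notation TR := (measurableTypeR R).

Lemma measurable_unit_square : measurable (unit_square R : set (TR * TR)).
Proof. by apply: measurableX; exact: measurable_itv. Qed.

Lemma restrict_unit_square (g : TR * TR -> \bar R) x y :
  (g \_ (unit_square R)) (x, y) =
  ((fun x => (fun y => g (x, y)) \_ `[0, 1] y) \_ `[0, 1]) x.
Proof.
rewrite !patchE /unit_square.
have [x01|x01] := boolP (x \in `[0, 1]%classic); last first.
  by rewrite memNset// => -[xx _]; move: x01; rewrite notin_setE; apply.
have [y01|y01] := boolP (y \in `[0, 1]%classic).
  by rewrite mem_set//; split; exact/set_mem.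
by rewrite memNset// => -[_ yy]; move: y01; rewrite notin_setE; apply.
Qed.

Lemma integral_unit_square (g : TR * TR -> \bar R) :
  (lebesgue2 R).-integrable (unit_square R) g ->
  (\int[lebesgue2 R]_(z in unit_square R) g z =
   \int[mu]_(x in `[0%R, 1%R]) \int[mu]_(y in `[0%R, 1%R]) g (x, y))%E.
Proof.
move=> ig; rewrite integral_mkcond /lebesgue2.
rewrite -integral12_prod_meas1; last first.
  by apply/(integrable_mkcond _ measurable_unit_square).1.
rewrite [RHS]integral_mkcond; apply: eq_integral => x _; rewrite /fubini_F.
under eq_integral do rewrite restrict_unit_square.
rewrite patchE; case: ifPn => x01.
  rewrite [RHS]integral_mkcond; apply: eq_integral => y _.
  by rewrite [LHS]patchE x01.
by rewrite integral0_eq// => y _; rewrite patchE (negbTE x01).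
Qed.

(** Integrability of every section, and not only of almost every one, makes
    the inner integrals finite everywhere, so that Fubini's theorem passes to
    real-valued integrals. *)
Lemma Rintegral_unit_square (g : TR * TR -> R) :
  (lebesgue2 R).-integrable (unit_square R) (EFin \o g) ->
  (forall x, x \in `[0, 1] -> mu.-integrable `[0, 1] (fun y => (g (x, y))%:E)) ->
  \int[lebesgue2 R]_(z in unit_square R) g z =
  \int[mu]_(x in `[0, 1]) \int[mu]_(y in `[0, 1]) g (x, y).
Proof.
move=> ig iy; rewrite /Rintegral integral_unit_square//; congr fine.
apply: eq_integral => x /[1!inE] x01.
by rewrite fineK// integrable_fin_num//; exact: iy.
Qed.

Lemma cintegral_unit_square (f : TR * TR -> C) :
  cintegrable (lebesgue2 R) (unit_square R) f ->
  (forall x, x \in `[0, 1] -> cintegrable mu `[0, 1] (fun y => f (x, y))) ->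
  cintegral (lebesgue2 R) (unit_square R) f =
  cintegral mu `[0, 1] (fun x => cintegral mu `[0, 1] (fun y => f (x, y))).
Proof.
move=> [f1 f2] iy; rewrite /cintegral /=.
by rewrite !Rintegral_unit_square// => x /iy[].
Qed.

Variable al : C.
Hypothesis al_gt : -1 < Re al.

Lemma measurable_dist : measurable_fun setT (fun z : TR * TR => `|z.1 - z.2| : TR).
Proof.
apply: (@measurableT_comp _ _ _ _ _ _ (@Num.norm _ R)); first exact: normr_measurable.
by apply: measurable_funB; [exact: measurable_fst|exact: measurable_snd].
Qed.

(** By Tonelli: the inner integrals have been computed, and they depend
    continuously on x. *)
Lemma dist_power_integrable :
  (lebesgue2 R).-integrable (unit_square R)
    (EFin \o (fun z : TR * TR => expR (Re al * ln `|z.1 - z.2|))).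
Proof.
set k := EFin \o _.
have mk : measurable_fun setT k.
  apply/measurable_EFinP; apply: (measurableT_comp (@measurable_expR R)).
  apply: measurable_funM; first exact: measurable_cst.
  exact: (measurableT_comp (@measurable_ln R) measurable_dist).
apply/(integrable_mkcond _ measurable_unit_square); apply/integrable12ltyP.
  apply/(measurable_restrictT _ measurable_unit_square).
  exact: measurable_funTS.
(* the kernel is the power with the real exponent Re al *)
pose be : C := (Re al)%:C.
pose c x := Re (cprim be 1%:P x + cprim be 1%:P (1 - x)).
have inner x : x \in `[0, 1] -> (\int[mu]_(y in `[0%R, 1%R]) k (x, y) = (c x)%:E)%E.
  rewrite in_itv/= => x01.
  have [[i1 _] /(congr1 (@complex.Re R))] :=
    cintegral_cpow_dist (al := be) al_gt 1%:P x01.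
  rewrite !comp_polyC -[RHS]/(c x) => <-.
  rewrite /Rintegral fineK; last exact: integrable_fin_num.
  by apply: eq_integral => y _; rewrite hornerC mulr1 Re_cpow /= mul0r cos0 mulr1.
have c_cont : continuous c.
  have c0 (u : R) : {for u, continuous (fun t : R => Re (cprim be 1%:P t))}.
    by have [] := @cprim_continuous _ be al_gt 1%:P u.
  move=> x.
  have -> : c = (fun x : R => Re (cprim be 1%:P x)) +
      ((fun t : R => Re (cprim be 1%:P t)) \o (fun x : R => 1 - x)).
    by apply/funext => u; rewrite /c Re_add.
  apply: continuousD; first exact: c0.
  apply: continuous_comp; last exact: c0.
  by apply: cvgB; [exact: cvg_cst|exact: cvg_id].
have c_int : mu.-integrable `[0, 1] (EFin \o c).
  apply: continuous_compact_integrable; first exact: segment_compact.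
  exact: continuous_subspaceT.
apply: le_lt_trans (integrable_lty _ c_int) => //.
rewrite [leRHS]integral_mkcond le_eqVlt; apply/orP; left; apply/eqP.
apply: eq_integral => x _.
under eq_integral do rewrite restrict_unit_square.
rewrite [RHS]patchE; case: ifPn => x01.
  rewrite /= -inner; last by move: x01; rewrite inE.
  rewrite [RHS]integral_mkcond; apply: eq_integral => y _.
  rewrite [in LHS]patchE x01 !patchE; case: ifPn => // _.
    by rewrite gee0_abs// lee_fin expR_ge0.
  by rewrite abse0.
rewrite integral0_eq// => y _; by rewrite patchE (negbTE x01) abse0.
Qed.

Lemma cintegrable_cpow_dist2 (p q : {poly C}) :
  cintegrable (lebesgue2 R) (unit_square R)
    (fun z => cpow `|z.1 - z.2| al * (p.[z.1%:C] * q.[z.2%:C])).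
Proof.
have [M HM] := horner_bounded p 1; have [N HN] := horner_bounded q 1.
set f := fun z => _.
have mf : cmeasurable f.
  apply: cmeasurableM.
    exact: (cmeasurable_comp (cmeasurable_cpow al) measurable_dist).
  apply: cmeasurableM.
    exact: (cmeasurable_comp (cmeasurable_horner p) (@measurable_fst _ _ TR TR)).
  exact: (cmeasurable_comp (cmeasurable_horner q) (@measurable_snd _ _ TR TR)).
apply: (@cintegrable_dominated _ _ _ (lebesgue2 R) (unit_square R) f
    (fun z => Re (M * N) * expR (Re al * ln `|z.1 - z.2|))).
- exact: measurable_unit_square.
- exact: mf.
- exact: (integrableZl measurable_unit_square (Re (M * N)) dist_power_integrable).
- move=> [x y] [] /=; rewrite !in_itv/= => /andP[x0 x1] /andP[y0 y1].
  rewrite /f /= normrM normc_cpow mulrC rmorphM /=.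
  rewrite ler_wpM2r ?ler0c ?expR_ge0// normrM.
  have px : `|p.[x%:C]| <= M by apply: HM; rewrite normc_real lecR ger0_norm.
  have qy : `|q.[y%:C]| <= N by apply: HN; rewrite normc_real lecR ger0_norm.
  have pq : `|p.[x%:C]| * `|q.[y%:C]| <= M * N by apply: ler_pM.
  rewrite (le_trans pq)// RRe_real//.
  by rewrite ger0_real// (le_trans _ pq)// mulr_ge0.
Qed.

Lemma cprim_left (q : {poly C}) (x : R) :
  cprim al (q \Po (x%:C%:P - 'X)) x = cpow x al * x%:C * (beta_op (al + 1) q).[x%:C].
Proof. by rewrite /cprim mprim_comp_sub//; exact: al_shift_neq0. Qed.

Lemma cpow1 : cpow (1 : R) al = 1.
Proof.
apply: complexP; rewrite ?Re_cpow ?Im_cpow ln1 !mulr0 expR0.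
  by rewrite cos0 mulr1.
by rewrite sin0 mulr0.
Qed.

Lemma cprim1 (q : {poly C}) : cprim al q 1 = moment (al + 1) q.
Proof. by rewrite /cprim cpow1 rmorph1 !mul1r. Qed.

(** The part over [x, 1] is the part over [0, 1 - x] of the reflected data. *)
Lemma cintegral_cpow_dist_poly (q : {poly C}) (x : R) : 0 <= x <= 1 ->
  cintegral mu `[0, 1] (fun y => cpow `|x - y| al * q.[y%:C]) =
  cpow x al * ('X * beta_op (al + 1) q).[x%:C] +
  cpow (1 - x) al * ('X * beta_op (al + 1) (q \Po (1 - 'X))).[(1 - x)%:C].
Proof.
move=> x01; have [_ ->] := cintegral_cpow_dist al_gt q x01.
have -> : q \Po (x%:C%:P + 'X) = (q \Po (1 - 'X)) \Po ((1 - x)%:C%:P - 'X).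
  rewrite -comp_polyA; congr (_ \Po _).
  rewrite comp_polyB comp_polyX -{1}polyC1 comp_polyC polyC1.
  by rewrite rmorphB polyCB !rmorph1; ring.
by rewrite !cprim_left !hornerM !hornerX !mulrA.
Qed.

(** After the inner integration the outer integrand is again a power times a
    polynomial, singular at x = 0 for the triangle y < x and at x = 1 for the
    other one. *)
Lemma cintegral_cpow_dist2 (p q : {poly C}) :
  cintegral (lebesgue2 R) (unit_square R)
    (fun z => cpow `|z.1 - z.2| al * (p.[z.1%:C] * q.[z.2%:C])) =
  half_pairing (al + 1) p q +
  half_pairing (al + 1) (p \Po (1 - 'X)) (q \Po (1 - 'X)).
Proof.
have inner_eq x y : cpow `|x - y| al * (p.[x%:C] * q.[y%:C]) =
    cpow `|x - y| al * (p.[x%:C] *: q).[y%:C] by rewrite hornerZ.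
have c1p (r : {poly C}) : (1 : {poly C}) \Po r = 1 by rewrite -polyC1 comp_polyC.
have refl (r : {poly C}) : (r \Po (1 - 'X)) \Po (1 - 'X) = r.
  rewrite -comp_polyA comp_polyB comp_polyX c1p.
  by rewrite opprB addrC subrK comp_polyXr.
pose p' := p \Po (1 - 'X); pose q' := q \Po (1 - 'X).
pose Q0 := 'X * (p * beta_op (al + 1) q).
pose Q1 := ('X * (p' * beta_op (al + 1) q')) \Po (1 - 'X).
rewrite cintegral_unit_square; first last.
- move=> x; rewrite in_itv => x01.
  rewrite (_ : (fun y => _) =
      (fun y => cpow `|x - y| al * (p.[x%:C] *: q).[y%:C])).
    by have [] := cintegral_cpow_dist al_gt (p.[x%:C] *: q) x01.
  by apply/funext => y; exact: inner_eq.
- exact: cintegrable_cpow_dist2.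
rewrite (@eq_cintegral _ _ _ mu `[0, 1] _
   (fun x => cpow `|0 - x| al * Q0.[x%:C] + cpow `|1 - x| al * Q1.[x%:C])); last first.
  move=> x; rewrite mem_setE in_itv => x01; have /andP[x0 x1] := x01.
  rewrite (_ : (fun y => _) =
      (fun y => cpow `|x - y| al * (p.[x%:C] *: q).[y%:C])); last first.
    by apply/funext => y; exact: inner_eq.
  rewrite cintegral_cpow_dist_poly// comp_polyZ !beta_opZ sub0r normrN ger0_norm//.
  rewrite ger0_norm ?subr_ge0// /Q0 /Q1 !comp_polyM refl comp_polyX.
  rewrite !hornerM !hornerZ !horner_comp !hornerX.
  have -> : (1 - 'X).[x%:C] = (1 - x)%:C.
    by rewrite hornerD hornerN hornerX hornerC rmorphB.
  by congr (_ + _); congr (_ * _); ring.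
have [I0 E0] :=
  @cintegral_cpow_dist _ al al_gt Q0 0 (introT andP (conj (lexx 0) ler01)).
have [I1 E1] :=
  @cintegral_cpow_dist _ al al_gt Q1 1 (introT andP (conj ler01 (lexx 1))).
rewrite cintegralD// E0 E1 subrr subr0 !cprim0 add0r addr0 !cprim1.
rewrite !rmorph0 !rmorph1 add0r comp_polyXr /Q1 refl /half_pairing.
by rewrite -/p' -/q' /Q0 -(expr1 'X) !moment_XnM.
Qed.

End DoubleIntegral.

(** * From the Legendre family to the closed form *)

Section LegendreOverC.
Variable R : realType.
Notation C := R[i].
Notation toC := (real_complex R).

Lemma moment_map (q : {poly R}) : moment 1 (map_poly toC q) = (moment 1 q)%:C.
Proof.
rewrite (@momentE _ 1 _ (size q)) ?size_map_poly// (@momentE _ 1 q (size q))//.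
rewrite rmorph_sum; apply: eq_bigr => k _.
by rewrite coef_map fmorph_div /= rmorphD rmorph1 rmorph_nat.
Qed.

(** The substitution x -> 2 x - 1, again through antiderivatives. *)
Lemma moment_shifted (q : {poly R}) :
  moment 1 (shifted q) = 2^-1 * \int[lebesgue_measure]_(x in `[(-1 : R), 1]) q.[x].
Proof.
have [W WE] := exists_primitive q.
have -> : \int[lebesgue_measure]_(x in `[(-1 : R), 1]) q.[x] = W.[1] - W.[-1].
  apply: (@Rintegral_FTC2_oo _ (fun x => q.[x]) (fun x => W.[x])).
  - lra.
  - apply: continuous_compact_integrable; first exact: segment_compact.
    exact/continuous_subspaceT/continuous_horner.
  - by move=> x _; exact: continuous_horner.
  - exact: continuous_horner.
  - by move=> x _; rewrite -WE; exact: is_derive_poly.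
have -> : shifted q = (2^-1 *: (W \Po (2%:P * 'X - 1)))^`().
  have dl : (2%:P * 'X - 1)^`() = 2%:P :> {poly R}.
    by rewrite derivB -polyC1 derivC subr0 derivM derivX derivC mul0r add0r mulr1.
  rewrite derivZ deriv_comp WE dl [_ * 2%:P]mulrC [X in _ *: X]mul_polyC.
  by rewrite scalerA mulVf ?pnatr_eq0// scale1r.
rewrite moment_deriv !hornerZ -mulrBr; congr (_ * (_ - _)).
  rewrite horner_comp !hornerE; congr (_.[_]); lra.
by rewrite horner_comp !hornerE; congr (_.[_]); lra.
Qed.

Variable P : nat -> {poly R}.
Hypothesis P_legendre : legendre_family P.

Definition shiftedC n : {poly C} := map_poly toC (shifted (P n)).

Lemma size_shiftedC n : size (shiftedC n) = n.+1.
Proof.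
have [hs _ _] := P_legendre; rewrite size_map_poly size_comp_poly2 ?hs//.
have s2X : size (2%:P * 'X : {poly R}) = 2%N.
  by rewrite mul_polyC size_scale ?pnatr_eq0// size_polyX.
by rewrite size_polyDl s2X// size_polyN size_poly1.
Qed.

Lemma shiftedC_orth (m n : nat) :
  m != n -> moment 1 (shiftedC m * shiftedC n) = 0.
Proof.
have [_ ho _] := P_legendre => mn.
rewrite -rmorphM moment_map -comp_polyM -/(shifted _) moment_shifted.
under eq_Rintegral do rewrite hornerM.
by rewrite ho// mulr0.
Qed.

Lemma shiftedC_at1 n : (shiftedC n).[1] = 1.
Proof.
have [_ _ h1] := P_legendre.
rewrite -(rmorph1 toC) horner_map /= horner_comp.
rewrite (_ : (2%:P * 'X - 1).[1] = 1) ?h1//.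
rewrite hornerD hornerN hornerM !hornerC hornerX; lra.
Qed.

End LegendreOverC.

Theorem theorem1 (R : realType) (P : nat -> {poly R})
    (P_legendre : legendre_family P)
    (m n : nat) (le_nm : (n <= m)%N) (even_d : ~~ odd (m - n))
    (alpha : R[i]) (alpha_gt : -1 < complex.Re alpha) :
  let d := (m - n)%N in
  let f := fun z : R * R =>
    cpow `|z.1 - z.2| alpha
    * ((shifted (P m)).[z.1] * (shifted (P n)).[z.2])%:C in
  cintegrable (lebesgue2 R) (unit_square R) f /\
  cintegral (lebesgue2 R) (unit_square R) f =
    2 / (alpha + 1)
    * ((pochhammer ((d%:R - alpha) / 2) n * pochhammer (- alpha - 1) d)
       / (pochhammer ((alpha + d%:R + 4) / 2) n
          * pochhammer (alpha + 2) d.+1)).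
Proof.
move=> d f.
pose p := shiftedC P.
have fE : f = fun z =>
    cpow `|z.1 - z.2| alpha * ((p m).[z.1%:C] * (p n).[z.2%:C]).
  by apply/funext => z; rewrite /f /p /shiftedC !horner_map rmorphM.
rewrite fE; split; first exact: cintegrable_cpow_dist2.
rewrite cintegral_cpow_dist2//.
have p_size := size_shiftedC P_legendre.
have p_orth := shiftedC_orth P_legendre.
have p_at1 := shiftedC_at1 P_legendre.
(* the two triangles contribute equally: (-1)^m (-1)^n = 1 *)
rewrite !(legendre_reflect p_size p_orth p_at1) half_pairingZ.
have mE : m = (n + d)%N by rewrite subnKC.
have -> : (-1) ^+ m * (-1) ^+ n = 1 :> R[i].
  rewrite mE addnC exprD -mulrA -expr2 -exprM mulnC exprM sqrrN !expr1n mulr1.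
  by rewrite -signr_odd (negbTE even_d).
rewrite mul1r mE.
have hs := al_shift_neq0 alpha_gt.
have two0 : 2 != 0 :> R[i] by rewrite pnatr_eq0.
have dn0 : pochhammer ((alpha + 1 + d%:R + 3) / 2) n != 0.
  apply: pochhammer_neq0 => i.
  have -> : (alpha + 1 + d%:R + 3) / 2 + i%:R =
      (alpha + 1 + (d + 3 + 2 * i)%:R) / 2.
    by rewrite (natrD _ (d + 3)) (natrD _ d) natrM; field.
  by rewrite mulf_neq0// invr_eq0.
rewrite (half_pairing_legendre p_size p_orth p_at1 hs dn0).
rewrite -signr_odd (negbTE even_d) expr0 mul1r.
have -> : (alpha + 1 + d%:R + 3) / 2 = (alpha + d%:R + 4) / 2 by congr (_ / _); ring.
have -> : (d%:R + 1 - (alpha + 1)) / 2 = (d%:R - alpha) / 2 by congr (_ / _); ring.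
have -> : - (alpha + 1) = - alpha - 1 by ring.
have -> : alpha + 1 + 1 = alpha + 2 by ring.
by rewrite (invfM (alpha + 1)); ring.
Qed.
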